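(* Let $R$ be a Noetherian commutative ring of prime characteristic $p>0$. Suppose that for each minimal prime $P$ of $R$, the domain $R/P$ has a module-finite extension domain $S \supseteq R/P$ (i.e. $S$ is a domain containing $R/P$ and finitely generated as an $R/P$-module) such that tight closure commutes with localization in $S$. Then tight closure commutes with localization in $R$.
   Context: All rings are commutative and Noetherian of prime characteristic $p>0$. For an ideal $I$ of a ring $A$ and $q=p^e$, $I^{[q]}$ denotes the ideal generated by $\{x^q : x\in I\}$. The tight closure $I^*$ of $I$ is the set of $z\in A$ for which there exists $c\in A$, not in any minimal prime of $A$, with $c z^q\in I^{[q]}$ for all $q=p^e \gg 0$. We say tight closure commutes with localization in $A$ if for every ideal $I$ of $A$ and every multiplicative system $U\subseteq A$, one has $I^*A[U^{-1}] = (IA[U^{-1}])^*$, where the right side is the tight closure in the ring $A[U^{-1}]$. *)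

(* Defs.v *)
From HB Require Import structures.
From mathcomp Require Import all_boot all_order all_algebra.
Set Implicit Arguments. Unset Strict Implicit. Unset Printing Implicit Defensive.
Import GRing.Theory.
Local Open Scope ring_scope.

Section Ideals.
Variable A : comPzRingType.

Definition is_ideal (I : A -> Prop) : Prop :=
  [/\ I 0, (forall x y, I x -> I y -> I (x + y)) & (forall r x, I x -> I (r * x))].

Definition gen_ideal (S : A -> Prop) : A -> Prop :=
  fun x => forall J, is_ideal J -> (forall y, S y -> J y) -> J x.

Definition is_prime_ideal (P : A -> Prop) : Prop :=
  [/\ is_ideal P, ~ P 1 & (forall x y, P (x * y) -> P x \/ P y)].

Definition is_minimal_prime (P : A -> Prop) : Prop :=
  is_prime_ideal P /\
  (forall Q, is_prime_ideal Q -> (forall x, Q x -> P x) -> forall x, P x -> Q x).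

Definition noetherian : Prop :=
  forall I, is_ideal I -> exists s : seq A, forall x, I x <-> gen_ideal (fun y => y \in s) x.

Definition is_domain : Prop :=
  (1 != 0 :> A) /\ (forall a b : A, a * b = 0 -> a = 0 \/ b = 0).

Definition frob_power (q : nat) (I : A -> Prop) : A -> Prop :=
  gen_ideal (fun y => exists x, I x /\ y = x ^+ q).

Definition tight_closure (p : nat) (I : A -> Prop) : A -> Prop :=
  fun z => exists c : A, (forall P, is_minimal_prime P -> ~ P c) /\
    exists N : nat, forall e : nat, (N <= e)%N -> frob_power (p ^ e) I (c * z ^+ (p ^ e)).

Definition mult_system (U : A -> Prop) : Prop :=
  U 1 /\ (forall u v, U u -> U v -> U (u * v)).

End Ideals.

Definition is_localization (A B : comPzRingType) (U : A -> Prop)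
    (f : {rmorphism A -> B}) : Prop :=
  [/\ (forall u, U u -> exists v, f u * v = 1),
      (forall b : B, exists a u, U u /\ b * f u = f a) &
      (forall a, f a = 0 -> exists u, U u /\ u * a = 0)].

Definition image_pred (A B : Type) (f : A -> B) (I : A -> Prop) : B -> Prop :=
  fun b => exists a, I a /\ b = f a.

Definition tc_commutes_with_localization (p : nat) (A : comPzRingType) : Prop :=
  forall (I : A -> Prop) (U : A -> Prop) (B : comPzRingType) (f : {rmorphism A -> B}),
    is_ideal I -> mult_system U -> is_localization U f ->
    forall b : B,
      gen_ideal (image_pred f (tight_closure p I)) b <->
      tight_closure p (gen_ideal (image_pred f I)) b.

Definition module_finite (A S : comPzRingType) (phi : {rmorphism A -> S}) : Prop :=
  exists s : seq S, forall y : S,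
    exists c : 'I_(size s) -> A, y = \sum_(i < size s) phi (c i) * s`_i.

(* Main.v *)
From HB Require Import structures.
Require Import Defs.
From mathcomp Require Import all_boot all_order all_algebra.
From mathcomp Require Import boolp ring generic_quotient.
Set Implicit Arguments.
Unset Strict Implicit.
Unset Printing Implicit Defensive.
Import GRing.Theory.
Local Open Scope ring_scope.

(** Let [b = a/u] lie in the tight closure of [I B], [B = R[U^-1]]. Tight closure
    can be tested modulo each minimal prime [P]: multipliers that work modulo the
    finitely many minimal primes lift to [R] after a Frobenius power, because [P]
    is nilpotent in the localization at [P], and prime avoidance glues them. For a
    fixed [P] disjoint from [U], push [a] to the localization of [S] at the image of
    [U], where the hypothesis gives [v] in [U] with [v a] in the tight closure of
    [I S]; a linear functional from [S] to [R/P] that does not kill the multiplier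
    brings this back to [R/P]. If [P] meets [U], any [v] in [P] and [U] works. The
    product of the [v]s handles all minimal primes at once. *)

(** * Ideals, Frobenius powers and tight closure *)

Section IdealTheory.
Variable A : comPzRingType.
Implicit Types (I J P Q : A -> Prop) (x y : A).

Lemma gen_ideal_ideal I : is_ideal (gen_ideal I).
Proof.
split=> [J [J0 _ _] _ // | x y Ix Iy J idJ IJ | r x Ix J idJ IJ].
  by case: (idJ) => _ JD _; apply: JD; [apply: Ix | apply: Iy].
by case: (idJ) => _ _ JM; apply: JM; apply: Ix.
Qed.

Lemma mem_gen_ideal I x : I x -> gen_ideal I x.
Proof. by move=> Ix J _; apply. Qed.

Lemma frob_power_ideal q I : is_ideal (frob_power q I).
Proof. exact: gen_ideal_ideal. Qed.

Lemma ideal_mulr I x r : is_ideal I -> I x -> I (x * r).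
Proof. by case=> _ _ IM Ix; rewrite mulrC; apply: IM. Qed.

Lemma ideal_oppr I x : is_ideal I -> I x -> I (- x).
Proof. by case=> _ _ IM Ix; rewrite -mulN1r; apply: IM. Qed.

Lemma ideal_subr I x y : is_ideal I -> I x -> I y -> I (x - y).
Proof. by move=> idI Ix Iy; case: (idI) => _ ID _; apply: ID => //; apply: ideal_oppr. Qed.

Lemma ideal_exprn I x n : is_ideal I -> (0 < n)%N -> I x -> I (x ^+ n).
Proof. by case: n => // n idI _ Ix; rewrite exprS; apply: ideal_mulr. Qed.

Lemma primeM P x y : is_prime_ideal P -> ~ P x -> ~ P y -> ~ P (x * y).
Proof. by case=> _ _ PM nx ny /PM [/nx | /ny]. Qed.

Lemma primeX P x n : is_prime_ideal P -> ~ P x -> ~ P (x ^+ n).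
Proof.
move=> prP nx; elim: n => [|n IH]; first by case: prP.
by rewrite exprS; apply: primeM.
Qed.

Lemma prime_proper_notin P Q : is_minimal_prime P -> is_minimal_prime Q ->
  P <> Q -> exists x, Q x /\ ~ P x.
Proof.
move=> [prP minP] [prQ minQ] neq; apply: contrapT => nex; apply: neq.
have QP x : Q x -> P x by move=> Qx; apply: contrapT => nPx; apply: nex; exists x.
by apply/predeqP => x; split; [apply: (minP _ prQ QP) | apply: QP].
Qed.

Lemma domain_zero_minimal : is_domain A -> is_minimal_prime (fun x : A => x = 0).
Proof.
move=> [/eqP n10 M0]; split; last first.
  by move=> Q [[Q0 _ _] _ _] _ x ->.
by split=> //; split=> // [x y -> ->|r x ->]; rewrite ?addr0 ?mulr0.
Qed.

Lemma domain_minimalE P : is_domain A -> is_minimal_prime P ->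
  forall x, P x -> x = 0.
Proof.
move=> domA [prP minP]; apply: (minP); first by case: (domain_zero_minimal domA).
by case: prP => -[P0 _ _] _ _ _ ->.
Qed.

End IdealTheory.

Lemma preim_ideal (A B : comPzRingType) (f : {rmorphism A -> B}) J :
  is_ideal J -> is_ideal (fun x => J (f x)).
Proof.
case=> J0 JD JM; split=> [|x y Jx Jy|r x Jx]; rewrite ?rmorph0 ?rmorphD ?rmorphM //.
  exact: JD.
exact: JM.
Qed.

Lemma preim_prime (A B : comPzRingType) (f : {rmorphism A -> B}) P :
  is_prime_ideal P -> is_prime_ideal (fun x => P (f x)).
Proof.
case=> idP P1 PM; split; first exact: preim_ideal.
  by rewrite rmorph1.
by move=> x y; rewrite rmorphM; apply: PM.
Qed.

Section Frobenius.
Variable p : nat.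
Hypothesis pr_p : prime p.

Lemma pexp_gt0 e : (0 < p ^ e)%N.
Proof. by rewrite expn_gt0 prime_gt0. Qed.

(** In the exponent [p] all binomial coefficients but the two extreme ones are divisible by [p],
    hence zero in [A]; induction on [e] iterates this. *)
Lemma frobD (A : comPzRingType) e (x y : A) : p%:R = 0 :> A ->
  (x + y) ^+ (p ^ e) = x ^+ (p ^ e) + y ^+ (p ^ e).
Proof.
move=> p0; elim: e => [|e IH] in x y *; first by rewrite !expr1.
rewrite expnS !exprM -IH; congr (_ ^+ _); rewrite exprDn.
rewrite -(prednK (prime_gt0 pr_p)) big_ord_recl big_ord_recr /= /bump add1n.
rewrite prednK ?prime_gt0 // subn0 subnn !expr0 mulr1 mul1r bin0 binn !mulr1n.
rewrite big1 ?add0r // => i _.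
have /dvdnP[m ->] : (p %| 'C(p, 1 + i))%N.
  by rewrite prime_dvd_bin // add1n -ltn_predRL ltn_ord.
by rewrite mulrnA -mulr_natl p0 mul0r.
Qed.

(** Additivity of Frobenius is the point. As [gen_ideal] quantifies over all ideals, it can be
    instantiated with this preimage, so claims about [p ^ e]-th powers of its elements need only be
    checked on generators. *)
Lemma expr_ideal (A : comPzRingType) e (K : A -> Prop) : p%:R = 0 :> A ->
  is_ideal K -> is_ideal (fun x => K (x ^+ (p ^ e))).
Proof.
move=> p0 [K0 KD KM]; split=> [|x y Kx Ky|r x Kx].
- by rewrite expr0n gtn_eqF ?pexp_gt0.
- by rewrite frobD //; apply: KD.
- by rewrite exprMn; apply: KM.
Qed.

Lemma frob_power_expr (A : comPzRingType) e e' (I : A -> Prop) x : p%:R = 0 :> A ->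
  frob_power (p ^ e) I x -> frob_power (p ^ (e + e')) I (x ^+ (p ^ e')).
Proof.
move=> p0 /(_ (fun z => frob_power _ I (z ^+ (p ^ e')))); apply.
  exact/expr_ideal/gen_ideal_ideal.
by move=> _ [y [Iy ->]]; rewrite -exprM -expnD; apply: mem_gen_ideal; exists y.
Qed.

Lemma frob_power_gen_image (A B : comPzRingType) (f : {rmorphism A -> B}) e I y :
  p%:R = 0 :> B ->
  frob_power (p ^ e) (gen_ideal (image_pred f I)) y ->
  gen_ideal (image_pred f (frob_power (p ^ e) I)) y.
Proof.
set K := gen_ideal (image_pred f (frob_power _ I)) => p0.
apply=> [|_ [z [Iz ->]]]; first exact: gen_ideal_ideal.
apply: (Iz (fun z => K (z ^+ (p ^ e)))) => [|_ [a [Ia ->]]].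
  exact/expr_ideal/gen_ideal_ideal.
rewrite -rmorphXn; apply: mem_gen_ideal; exists (a ^+ (p ^ e)); split=> //.
by apply: mem_gen_ideal; exists a.
Qed.

Lemma frob_power_image (A B : comPzRingType) (f : {rmorphism A -> B}) q I x :
  frob_power q I x -> frob_power q (gen_ideal (image_pred f I)) (f x).
Proof.
set K := frob_power _ (gen_ideal _) => /(_ (fun z => K (f z))); apply=> [|_ [a [Ia ->]]].
  exact/preim_ideal/gen_ideal_ideal.
rewrite rmorphXn; apply: mem_gen_ideal; exists (f a); split=> //.
by apply: mem_gen_ideal; exists a.
Qed.

Lemma tight_closure_ideal (A : comPzRingType) (I : A -> Prop) : p%:R = 0 :> A ->
  is_ideal (tight_closure p I).
Proof.
move=> p0; split.
- exists 1; split; first by move=> P [[]].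
  exists 0%N => e _; rewrite expr0n gtn_eqF ?pexp_gt0 //= mulr0.
  by case: (frob_power_ideal (p ^ e) I).
- move=> x y [c [nc [n cx]]] [d [nd [m dy]]]; exists (c * d); split.
    by move=> P minP; apply: primeM (nc P minP) (nd P minP); case: minP.
  exists (maxn n m) => e; rewrite geq_max => /andP[le_n le_m].
  rewrite frobD // mulrDr mulrAC -[c * d * _]mulrA.
  have [_ ID IM] := frob_power_ideal (p ^ e) I.
  apply: ID; last by apply: IM; apply: dy.
  by rewrite mulrC; apply: IM; apply: cx.
- move=> r x [c [nc [n cx]]]; exists c; split=> //; exists n => e le_n.
  have [_ _ IM] := frob_power_ideal (p ^ e) I.
  by rewrite exprMn mulrCA; apply: IM; apply: cx.
Qed.

End Frobenius.

(** * Localization *)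

Section Localization.
Variables (A B : comPzRingType) (U : A -> Prop) (f : {rmorphism A -> B}).
Hypotheses (multU : mult_system U) (locf : is_localization U f).

Lemma loc_unitK u : U u -> exists v, v * f u = 1.
Proof. by case: locf => h _ _ /h [v]; exists v; rewrite mulrC. Qed.

Lemma loc_cancel u b c : U u -> b * f u = c * f u -> b = c.
Proof.
move=> /loc_unitK [v vu] E.
by rewrite -[b]mulr1 -[c]mulr1 -vu [v * _]mulrC !mulrA E.
Qed.

Lemma loc_eq a a' : f a = f a' -> exists u, U u /\ u * a = u * a'.
Proof.
case: locf => _ _ h /eqP; rewrite -subr_eq0 -rmorphB => /eqP /h [u [Uu E]].
by exists u; split=> //; apply/eqP; rewrite -subr_eq0 -mulrBr E.
Qed.

(** For an ideal [J] this is the extension of [J] to [B], described by fractions with numerator in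
    [J], so that a single denominator can be cleared. *)
Definition loc_ext (J : A -> Prop) (b : B) : Prop :=
  exists a u, [/\ J a, U u & b * f u = f a].

Lemma loc_ext_ideal J : is_ideal J -> is_ideal (loc_ext J).
Proof.
case: multU => U1 UM [J0 JD JM]; split.
- by exists 0, 1; split=> //; rewrite mul0r rmorph0.
- move=> b b' [a [u [Ja Uu E]]] [a' [u' [Ja' Uu' E']]].
  exists (u' * a + u * a'), (u * u'); split; [|exact: UM|].
    by apply: JD; apply: JM.
  rewrite rmorphD !rmorphM -E -E'; ring.
- move=> r b [a [u [Ja Uu E]]]; case: locf => _ /(_ r) [a' [u' [Uu' E']]] _.
  exists (a' * a), (u' * u); split; [exact: JM|exact: UM|].
  rewrite !rmorphM -E -E'; ring.
Qed.

Lemma gen_image_locE J b : is_ideal J ->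
  gen_ideal (image_pred f J) b <-> loc_ext J b.
Proof.
move=> idJ; split.
  move=> /(_ _ (loc_ext_ideal idJ)); apply=> _ [a [Ja ->]].
  by case: multU => U1 _; exists a, 1; split=> //; rewrite rmorph1 mulr1.
move=> [a [u [Ja Uu E]]]; have [v vu] := loc_unitK Uu.
rewrite -[b]mulr1 -vu [v * _]mulrC mulrA E.
apply: (ideal_mulr v (gen_ideal_ideal _)).
by apply: mem_gen_ideal; exists a.
Qed.

Section Prime.
Variable P : A -> Prop.
Hypotheses (prP : is_prime_ideal P) (PU : forall u, U u -> ~ P u).

Lemma loc_ext_prime_image a : loc_ext P (f a) -> P a.
Proof.
case=> x [u [Px Uu]]; rewrite -rmorphM => /loc_eq [w [Uw E]].
case: (prP) => idP _ PM; have : P (w * (a * u)).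
  by rewrite E; case: idP => _ _; apply.
by move=> /PM [/(PU Uw) | /PM [// | /(PU Uu)]].
Qed.

Lemma loc_ext_prime : is_prime_ideal (loc_ext P).
Proof.
case: (prP) => idP P1 PM; split; first exact: loc_ext_ideal.
  by rewrite -(rmorph1 f) => /loc_ext_prime_image.
move=> b b' bb'; case: (locf) => _ fr _.
have [a [u [Uu E]]] := fr b; have [a' [u' [Uu' E']]] := fr b'.
have : loc_ext P (f (a * a')).
  rewrite rmorphM -E -E' mulrACA mulrC.
  by case: (loc_ext_ideal idP) => _ _; apply.
by move=> /loc_ext_prime_image /PM [] Px; [left; exists a, u | right; exists a', u'].
Qed.

End Prime.

Lemma loc_ext_minimal P : is_minimal_prime P -> (forall u, U u -> ~ P u) ->
  is_minimal_prime (loc_ext P).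
Proof.
move=> [prP minP] PU; split; first exact: loc_ext_prime.
move=> Q prQ QP b [a [u [Pa Uu E]]].
have Qa : Q (f a).
  apply: (minP _ (preim_prime f prQ)) Pa => x Qx.
  by apply: loc_ext_prime_image => //; apply: QP.
have [v vu] := loc_unitK Uu; rewrite -[b]mulr1 -vu [v * _]mulrC mulrA E.
by apply: ideal_mulr Qa; case: prQ.
Qed.

(** Elements of [U] become units in [B], so a prime [P] below the contraction of [Q] misses [U] and
    extends to a prime below [Q]; minimality of [Q] then gives equality. Hence a multiplier avoiding
    the minimal primes of [A] still avoids those of [B]. *)
Lemma preim_minimal Q : is_minimal_prime Q -> is_minimal_prime (fun a => Q (f a)).
Proof.
move=> [prQ minQ]; split=> [|P prP PQ a Qfa]; first exact: preim_prime.
have PU u : U u -> ~ P u.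
  move=> /loc_unitK [v vu] /PQ Qu; case: (prQ) => idQ Q1 _; apply: Q1.
  by rewrite -vu; case: idQ => _ _; apply.
apply: loc_ext_prime_image => //.
apply: (minQ) Qfa; first exact: loc_ext_prime.
move=> b [x [u [/PQ Qx Uu E]]]; have [v vu] := loc_unitK Uu.
rewrite -[b]mulr1 -vu [v * _]mulrC mulrA E.
by apply: ideal_mulr Qx; case: prQ.
Qed.

Lemma gen_image_tight_closure_sub p I b : prime p -> p%:R = 0 :> A ->
  gen_ideal (image_pred f (tight_closure p I)) b ->
  tight_closure p (gen_ideal (image_pred f I)) b.
Proof.
move=> pr_p p0; have p0B : p%:R = 0 :> B by rewrite -(rmorph_nat f) p0 rmorph0.
move=> /(_ _ (tight_closure_ideal pr_p _ p0B)); apply=> _ [z [[c [nc [n cz]]] ->]].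
exists (f c); split; first by move=> Q /preim_minimal /nc.
exists n => e le_n; rewrite -rmorphXn -rmorphM.
by apply: frob_power_image; apply: cz.
Qed.

(** The zero ideal of [A] is a prime disjoint from [U], and its extension to [B] is the zero
    ideal. *)
Lemma loc_domain : is_domain A -> ~ U 0 -> is_domain B.
Proof.
move=> domA U0; have [prZ _] := domain_zero_minimal domA.
have [|_ n1 M] := loc_ext_prime prZ.
  by move=> u Uu u0; apply: U0; rewrite -u0.
have ext0 b : loc_ext (fun x => x = 0) b <-> b = 0.
  split=> [[a [u [-> Uu E]]]|->].
    by apply: (loc_cancel Uu); rewrite E rmorph0 mul0r.
  by case: multU => U1 _; exists 0, 1; split=> //; rewrite mul0r rmorph0.
split; first by apply/eqP => E; apply: n1; apply/ext0.
by move=> b c /ext0 /M [] /ext0; [left|right].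
Qed.

End Localization.

(** * Construction of the ring of fractions *)

Section LocalizationConstruction.
Variables (A : comPzRingType) (U : A -> Prop).
Hypothesis multU : mult_system U.
Local Open Scope quotient_scope.

(** Membership in [U] is made Boolean so that the fractions form a choice type, of which a quotient
    can be taken. *)
Definition is_den (x : A * A) : bool := `[< U x.2 >].
Definition fraction := {x : A * A | is_den x}.
HB.instance Definition _ := Choice.on fraction.

Definition Frac (a : A) (u : A) (Uu : U u) : fraction :=
  exist is_den (a, u) (introT (asboolP (U (a, u).2)) Uu).

Local Notation num x := (sval x).1.
Local Notation den x := (sval x).2.

Lemma denP (x : fraction) : U (den x).
Proof. by case: x => x /= /asboolP. Qed.

Lemma denM (x y : fraction) : U (den x * den y).
Proof. by case: multU => _; apply; apply: denP. Qed.

(** The factor [w] secures transitivity when [U] contains zero divisors. *)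
Definition equiv_frac (x y : fraction) : bool :=
  `[< exists w, U w /\ w * (num x * den y) = w * (num y * den x) >].

Lemma equiv_frac_refl : reflexive equiv_frac.
Proof. by move=> x; apply/asboolP; exists 1; split=> //; case: multU. Qed.

Lemma equiv_frac_sym : symmetric equiv_frac.
Proof.
by move=> x y; apply/asboolP/asboolP => -[w [Uw E]]; exists w; rewrite E.
Qed.

Lemma equiv_frac_trans : transitive equiv_frac.
Proof.
move=> y x z /asboolP [w [Uw E]] /asboolP [w' [Uw' E']]; apply/asboolP.
exists (w * w' * den y); split.
  by case: multU => _ UM; apply: (UM); [exact: UM | exact: denP].
transitivity (w' * den z * (w * (num x * den y))); first by ring.
rewrite E; transitivity (w * den x * (w' * (num y * den z))); first by ring.
by rewrite E'; ring.
Qed.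

Canonical equiv_frac_equiv :=
  EquivRel equiv_frac equiv_frac_refl equiv_frac_sym equiv_frac_trans.

Definition locring := {eq_quot equiv_frac}.
HB.instance Definition _ : EqQuotient _ equiv_frac locring := EqQuotient.on locring.
HB.instance Definition _ := Choice.on locring.

Lemma locring_eq (x y : fraction) w : U w ->
  w * (num x * den y) = w * (num y * den x) -> \pi_locring x = \pi_locring y.
Proof. by move=> Uw E; apply/eqmodP/asboolP; exists w. Qed.

Lemma equiv_repr (x : fraction) : exists w, U w /\
  w * (num (repr (\pi_locring x)) * den x) = w * (num x * den (repr (\pi_locring x))).
Proof. by apply/asboolP; rewrite -[`[<_>]]/(equiv_frac _ _) -eqmodE reprK. Qed.

Definition add_frac (x y : fraction) : fraction :=
  Frac (num x * den y + num y * den x) (denM x y).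
Definition mul_frac (x y : fraction) : fraction := Frac (num x * num y) (denM x y).
Definition opp_frac (x : fraction) : fraction := Frac (- num x) (denP x).
Definition const_frac (a : A) : fraction := Frac a (proj1 multU).

Definition add_loc := lift_op2 locring add_frac.
Definition mul_loc := lift_op2 locring mul_frac.
Definition opp_loc := lift_op1 locring opp_frac.
Definition to_loc := lift_embed locring const_frac.
Canonical to_loc_pi := PiEmbed to_loc.

Lemma pi_add_loc : {morph \pi : x y / add_frac x y >-> add_loc x y}.
Proof.
move=> x y; unlock add_loc; symmetry.
have [w [Uw E]] := equiv_repr x; have [w' [Uw' E']] := equiv_repr y.
set x' := repr _ in E *; set y' := repr _ in E' *.
apply: (@locring_eq _ _ (w * w')); first by case: multU => _; apply.
rewrite /=.
transitivity (w * (num x' * den x) * w' * den y' * den y +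
  w' * (num y' * den y) * w * den x' * den x); first by ring.
by rewrite E E'; ring.
Qed.
Canonical pi_add_loc_morph := PiMorph2 pi_add_loc.

Lemma pi_mul_loc : {morph \pi : x y / mul_frac x y >-> mul_loc x y}.
Proof.
move=> x y; unlock mul_loc; symmetry.
have [w [Uw E]] := equiv_repr x; have [w' [Uw' E']] := equiv_repr y.
set x' := repr _ in E *; set y' := repr _ in E' *.
apply: (@locring_eq _ _ (w * w')); first by case: multU => _; apply.
rewrite /=; transitivity (w * (num x' * den x) * (w' * (num y' * den y))); first by ring.
by rewrite E E'; ring.
Qed.
Canonical pi_mul_loc_morph := PiMorph2 pi_mul_loc.

Lemma pi_opp_loc : {morph \pi : x / opp_frac x >-> opp_loc x}.
Proof.
move=> x; unlock opp_loc; symmetry; have [w [Uw E]] := equiv_repr x.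
by apply: (locring_eq Uw) => /=; rewrite !mulNr !mulrN E.
Qed.
Canonical pi_opp_loc_morph := PiMorph1 pi_opp_loc.

Lemma add_locA : associative add_loc.
Proof.
elim/quotW=> x; elim/quotW=> y; elim/quotW=> z; rewrite !piE.
by apply: (locring_eq (proj1 multU)) => /=; ring.
Qed.

Lemma add_locC : commutative add_loc.
Proof.
elim/quotW=> x; elim/quotW=> y; rewrite !piE.
by apply: (locring_eq (proj1 multU)) => /=; ring.
Qed.

Lemma add_loc0 : left_id (to_loc 0) add_loc.
Proof.
elim/quotW=> x; rewrite !piE.
by apply: (locring_eq (proj1 multU)) => /=; ring.
Qed.

Lemma add_locN : left_inverse (to_loc 0) opp_loc add_loc.
Proof.
elim/quotW=> x; rewrite !piE.
by apply: (locring_eq (proj1 multU)) => /=; ring.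
Qed.

HB.instance Definition _ :=
  GRing.isZmodule.Build locring add_locA add_locC add_loc0 add_locN.

Lemma mul_locA : associative mul_loc.
Proof.
elim/quotW=> x; elim/quotW=> y; elim/quotW=> z; rewrite !piE.
by apply: (locring_eq (proj1 multU)) => /=; ring.
Qed.

Lemma mul_locC : commutative mul_loc.
Proof.
elim/quotW=> x; elim/quotW=> y; rewrite !piE.
by apply: (locring_eq (proj1 multU)) => /=; ring.
Qed.

Lemma mul_loc1 : left_id (to_loc 1) mul_loc.
Proof.
elim/quotW=> x; rewrite !piE.
by apply: (locring_eq (proj1 multU)) => /=; ring.
Qed.

Lemma mul_locDl : left_distributive mul_loc add_loc.
Proof.
elim/quotW=> x; elim/quotW=> y; elim/quotW=> z; rewrite !piE.
by apply: (locring_eq (proj1 multU)) => /=; ring.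
Qed.

HB.instance Definition _ :=
  GRing.Zmodule_isComPzRing.Build locring mul_locA mul_locC mul_loc1 mul_locDl.

Lemma to_loc_zmod : zmod_morphism to_loc.
Proof.
move=> a b; rewrite -[RHS]/(add_loc _ (opp_loc _)) !piE.
by apply: (locring_eq (proj1 multU)) => /=; ring.
Qed.

Lemma to_loc_monoid : monoid_morphism to_loc.
Proof.
split=> // a b; rewrite -[RHS]/(mul_loc _ _) !piE.
by apply: (locring_eq (proj1 multU)) => /=; ring.
Qed.

HB.instance Definition _ := GRing.isZmodMorphism.Build A locring to_loc to_loc_zmod.
HB.instance Definition _ := GRing.isMonoidMorphism.Build A locring to_loc to_loc_monoid.

(** The assumption on tight closure in [S] speaks of any ring with the properties of a localization;
    this supplies one to which it can be applied. *)
Lemma localization_exists :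
  exists (B : comPzRingType) (f : {rmorphism A -> B}), is_localization U f.
Proof.
exists locring, to_loc; split.
- move=> u Uu; exists (\pi_locring (Frac 1 Uu)).
  rewrite -[LHS]/(mul_loc _ _) -[RHS]/(to_loc 1) !piE.
  by apply: (locring_eq (proj1 multU)) => /=; ring.
- elim/quotW=> x; exists (num x), (den x); split; first exact: denP.
  rewrite -[LHS]/(mul_loc _ (to_loc _)) -[RHS]/(to_loc _) !piE.
  by apply: (locring_eq (proj1 multU)) => /=; ring.
- move=> a /= a0; have : \pi_locring (const_frac a) = \pi_locring (const_frac 0).
    by move: a0; rewrite -[0]/(to_loc 0) !piE.
  move=> /eqmodP /asboolP [w [Uw E]].
  by exists w; split=> //; move: E; rewrite /= !mulr1 mulr0.
Qed.

End LocalizationConstruction.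

(** * Minimal primes of Noetherian rings *)

Section NoetherianRing.
Variable A : comPzRingType.
Implicit Types (I J P Q : A -> Prop) (L : seq (A -> Prop)).

(** Every counterexample has a strictly larger one, so choice yields a strictly increasing chain of
    ideals, which the finite generation of its union contradicts. *)
Lemma noetherian_ind (H : (A -> Prop) -> Prop) : noetherian A ->
  (forall J, is_ideal J ->
     (forall K, is_ideal K -> (forall x, J x -> K x) ->
        (exists x, K x /\ ~ J x) -> H K) -> H J) ->
  forall J, is_ideal J -> H J.
Proof.
move=> noeth step J0 idJ0; apply: contrapT => nHJ0.
pose bad := {J | is_ideal J /\ ~ H J}.
have grow (J : bad) : exists K : bad,
    (forall x, sval J x -> sval K x) /\ exists x, sval K x /\ ~ sval J x.
  case: J => J [idJ nHJ] /=; apply: contrapT => nK; apply: nHJ.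
  apply: step => // K idK JK KnJ; apply: contrapT => nHK.
  by apply: nK; exists (exist _ K (conj idK nHK)).
have [next nextP] := choice grow.
pose chain n := sval (iter n next (exist _ J0 (conj idJ0 nHJ0))).
have chain_ideal n : is_ideal (chain n).
  by case: (svalP (iter n next (exist _ J0 (conj idJ0 nHJ0)))).
have chain_le m n x : (m <= n)%N -> chain m x -> chain n x.
  move=> /subnK <-; elim: (n - m)%N => // k IH /IH.
  by case: (nextP (iter (k + m) next (exist _ J0 (conj idJ0 nHJ0)))) => + _; apply.
pose V x := exists n, chain n x.
have idV : is_ideal V.
  split; first by exists 0%N; case: (chain_ideal 0%N).
    move=> x y [n nx] [m my]; exists (maxn n m).
    have [_ ID _] := chain_ideal (maxn n m).
    apply: ID; first exact: chain_le _ _ _ (leq_maxl n m) nx.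
    exact: chain_le _ _ _ (leq_maxr n m) my.
  by move=> r x [n nx]; exists n; case: (chain_ideal n) => _ _; apply.
have [s sV] := noeth V idV.
(* The finitely many generators of the union already lie in one member of the chain. *)
have [n sn] : exists n, forall x, x \in s -> chain n x.
  have : forall x, x \in s -> V x by move=> x xs; apply/sV; apply: mem_gen_ideal.
  elim: s {sV} => [|x s IH] sV; first by exists 0%N.
  have [n xn] := sV x (mem_head _ _).
  have [|m sm] := IH; first by move=> y ys; apply: sV; rewrite inE ys orbT.
  exists (maxn n m) => y; rewrite inE => /predU1P[->|/sm ym].
    exact: chain_le _ _ _ (leq_maxl n m) xn.
  exact: chain_le _ _ _ (leq_maxr n m) ym.
case: (nextP (iter n next (exist _ J0 (conj idJ0 nHJ0)))) => _ [x [xn1 nxn]].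
by apply: nxn; apply: (proj1 (sV x)); [exists n.+1 | exact: chain_ideal | exact: sn].
Qed.

(** * Products of primes and finiteness of the set of minimal primes *)

(** These are products of one element from each member of [L], which generate the product ideal;
    containment in an ideal can be tested on them. *)
Fixpoint prod_mem L x : Prop :=
  if L is Q :: L' then exists y z, [/\ Q y, prod_mem L' z & x = y * z] else x = 1.

Lemma prod_mem_cat L L' x : prod_mem (L ++ L') x ->
  exists y z, [/\ prod_mem L y, prod_mem L' z & x = y * z].
Proof.
elim: L x => [|Q L IH] x /= => [Lx|[y [z [Qy /IH [y' [z' [Ly' Lz' ->]]] ->]]]].
  by exists 1, x; rewrite mul1r.
by exists (y * y'), z'; split=> //; [exists y, y' | rewrite mulrA].
Qed.

Definition add_principal J a x : Prop := exists j r, J j /\ x = j + r * a.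

Lemma add_principal_ideal J a : is_ideal J -> is_ideal (add_principal J a).
Proof.
case=> J0 JD JM; split; first by exists 0, 0; rewrite mul0r addr0.
  move=> _ _ [j [r [Jj ->]]] [k [t [Jk ->]]]; exists (j + k), (r + t).
  by split; [exact: JD | ring].
by move=> c _ [j [r [Jj ->]]]; exists (c * j), (c * r); split; [exact: JM | ring].
Qed.

(** Noetherian induction: if [a * b] lies in [J] but neither factor does, the product of [J + (a)]
    and [J + (b)] lies in [J], so their lists are concatenated. The unit ideal takes the empty list,
    whose only product is 1. *)
Lemma noetherian_prime_product J : noetherian A -> is_ideal J ->
  exists L, (forall Q, Q \in L -> is_prime_ideal Q) /\ forall x, prod_mem L x -> J x.
Proof.
move=> noeth; elim/noetherian_ind: J / => // J idJ IH.
have [J1|nJ1] := pselect (J 1); first by exists [::]; split=> // x ->.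
have [PJ|nPJ] := pselect (forall x y, J (x * y) -> J x \/ J y).
  exists [:: J]; split=> [Q|x [y [z [Jy -> ->]]]]; last by rewrite mulr1.
  by rewrite inE => /eqP ->.
have [a [b [Jab nJa nJb]]] : exists a b, [/\ J (a * b), ~ J a & ~ J b].
  apply: contrapT => nab; apply: nPJ => x y Jxy.
  apply: contrapT => /not_orP [nx ny]; apply: nab.
  by exists x, y.
have ext c : ~ J c -> exists L, (forall Q, Q \in L -> is_prime_ideal Q) /\
    forall x, prod_mem L x -> add_principal J c x.
  case: (idJ) => J0 _ _ nJc; apply: IH; first exact: add_principal_ideal.
    by move=> x Jx; exists x, 0; rewrite mul0r addr0.
  by exists c; split=> //; exists 0, 1; rewrite mul1r add0r.
have [La [prLa ina]] := ext a nJa; have [Lb [prLb inb]] := ext b nJb.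
exists (La ++ Lb); split.
  by move=> Q; rewrite mem_cat => /orP [/prLa | /prLb].
move=> _ /prod_mem_cat [_ [_ [/ina [j [r [Jj ->]]] /inb [k [t [Jk ->]]] ->]]].
have -> : (j + r * a) * (k + t * b) = (k + t * b) * j + r * a * k + r * t * (a * b) by ring.
by case: (idJ) => _ JD JM; apply: (JD); [apply: JD|]; apply: (JM).
Qed.

Lemma prime_prod_mem P L : is_prime_ideal P ->
  (forall x, prod_mem L x -> P x) -> exists2 Q, Q \in L & forall x, Q x -> P x.
Proof.
move=> prP LP; apply: contrapT => nQ.
have : exists x, prod_mem L x /\ ~ P x; last by case=> x [/LP].
elim: L nQ {LP} => [|Q L IH] nQ; first by exists 1; split=> //; case: prP.
have [|z [Lz nPz]] := IH.
  by move=> [Q' Q'L Q'P]; apply: nQ; exists Q' => //; rewrite inE Q'L orbT.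
have [y [Qy nPy]] : exists y, Q y /\ ~ P y.
  apply: contrapT => nex; apply: nQ; exists Q; rewrite ?mem_head // => x Qx.
  by apply: contrapT => nPx; apply: nex; exists x.
by exists (y * z); split; [exists y, z | apply: primeM].
Qed.

Lemma zero_ideal : is_ideal (fun x : A => x = 0).
Proof. by split=> // [x y -> ->|r x ->]; rewrite ?addr0 ?mulr0. Qed.

(** A minimal prime contains a product of primes that is zero, hence contains one of these primes
    and equals it. The list may hold other primes too, so inductions over it test each entry for
    minimality. *)
Lemma noetherian_finite_minimal_primes : noetherian A ->
  exists L : seq (A -> Prop), forall P, is_minimal_prime P -> P \in L.
Proof.
move=> noeth; have [L [prL zL]] := noetherian_prime_product noeth zero_ideal.
exists L => P [prP minP].
have [|Q QL QP] := @prime_prod_mem P L prP.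
  by move=> x /zL ->; case: prP => -[].
suff -> : P = Q by [].
by apply/predeqP => x; split; [apply: minP (prL _ QL) QP x | apply: QP].
Qed.

(* The localization at a minimal prime is Artinian local: its maximal ideal is nilpotent. *)
Lemma minimal_prime_nilpotent P : noetherian A -> is_minimal_prime P ->
  exists d n, ~ P d /\ forall y, P y -> d * y ^+ n = 0.
Proof.
move=> noeth [prP minP].
have [L [prL zL]] := noetherian_prime_product noeth zero_ideal.
suff [d [n [nPd dn]]] : exists d n, ~ P d /\ forall y, P y -> prod_mem L (d * y ^+ n).
  by exists d, n; split=> // y /dn /zL.
elim: L prL {zL} => [|Q L IH] prL.
  exists 1, 0%N; split; first by case: prP.
  by move=> y _; rewrite expr0 mulr1.
have [|d [n [nPd dn]]] := IH; first by move=> Q' Q'L; apply: prL; rewrite inE Q'L orbT.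
(* If [Q] lies below [P], minimality puts [y] in [Q] and one more power of [y] is spent; otherwise
   an element of [Q] outside [P] is absorbed into [d]. *)
have [QP|nQP] := pselect (forall x, Q x -> P x).
  exists d, n.+1; split=> // y Py; exists y, (d * y ^+ n); split.
  - exact: (minP Q (prL _ (mem_head _ _)) QP).
  - exact: dn.
  - by rewrite exprS mulrCA.
have [q [Qq nPq]] : exists q, Q q /\ ~ P q.
  apply: contrapT => nex; apply: nQP => x Qx.
  by apply: contrapT => nPx; apply: nex; exists x.
exists (q * d), n; split; first exact: primeM.
by move=> y Py; exists q, (d * y ^+ n); split=> //; [exact: dn | rewrite mulrA].
Qed.

(** The primes are treated one at a time. If [x] falls into [P], add [y * j] with [j] in [J] outside
    [P], and [y] outside [P] but in all minimal primes already treated: this leaves [P] and enters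
    none of those. *)
Lemma minimal_prime_avoidance (J : A -> Prop) : noetherian A ->
  (forall x y, J x -> J y -> J (x + y)) -> (forall r x, J x -> J (r * x)) ->
  J 0 ->
  (forall P, is_minimal_prime P -> exists x, J x /\ ~ P x) ->
  exists x, J x /\ forall P, is_minimal_prime P -> ~ P x.
Proof.
move=> noeth JD JM J0 JnP.
have [L minL] := noetherian_finite_minimal_primes noeth.
suff [x [Jx nPx]] : exists x, J x /\ forall P, is_minimal_prime P -> P \in L -> ~ P x.
  by exists x; split=> // P minP; apply: nPx => //; apply: minL.
elim: L {minL} => [|P L [x [Jx nLx]]]; first by exists 0.
have [[minP Px]|nPx] := pselect (is_minimal_prime P /\ P x); last first.
  exists x; split=> // Q minQ; rewrite inE => /predU1P [QE Qx | /nLx]; last exact.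
  by apply: nPx; rewrite -QE.
have [y [Ly nPy]] : exists y,
    (forall Q, is_minimal_prime Q -> Q \in L -> Q y) /\ ~ P y.
  elim: L nLx => [|Q L IH] nLx.
    by exists 1; split=> //; case: minP => -[].
  have [|y [Ly nPy]] := IH; first by move=> Q' m Q'L; apply: nLx; rewrite ?inE ?Q'L ?orbT.
  have [minQ|nminQ] := pselect (is_minimal_prime Q); last first.
    exists y; split=> // Q' mQ'; rewrite inE => /predU1P [QE|/Ly]; last by apply.
    by rewrite QE in mQ'.
  (* [Q] differs from [P] because [x] lies in [P] but not in [Q]; distinct minimal primes are
     incomparable. *)
  have [|z [Qz nPz]] := prime_proper_notin minP minQ.
    by move=> PQ; apply: (nLx Q) => //; rewrite ?mem_head // -PQ.
  exists (z * y); split; last by apply: primeM => //; case: minP.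
  move=> Q' minQ'; have [[idQ' _ _] _] := minQ'.
  rewrite inE => /predU1P [Q'E|/(Ly _ minQ') Q'y].
    by rewrite Q'E in idQ' *; apply: ideal_mulr.
  by case: idQ' => _ _; apply.
have [j [Jj nPj]] := JnP P minP; exists (x + y * j); split.
  by apply: JD => //; apply: JM.
move=> Q minQ; have [[idQ _ _] _] := minQ; rewrite inE => /predU1P [QP|QL] Qxy.
  rewrite {}QP in idQ Qxy; have : P (y * j).
    by rewrite -[y * j](addKr x) addrC; apply: ideal_subr.
  by apply: primeM => //; case: minP.
apply: (nLx Q minQ QL); rewrite -[x](addrK (y * j)); apply: ideal_subr => //.
by apply: ideal_mulr => //; apply: Ly.
Qed.

End NoetherianRing.

(** * Module-finite extensions *)

Section ModuleFinite.
Variables (R S : comPzRingType) (phi : {rmorphism R -> S}).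

Definition span_mem n (t : 'I_n -> S) (y : S) : Prop :=
  exists c : 'I_n -> R, y = \sum_(i < n) phi (c i) * t i.

(** Independence over the image of [phi]: coefficients need only vanish in [S], because [phi] may
    have a kernel, which is [P] in the application. *)
Definition free_family n (t : 'I_n -> S) : Prop :=
  forall c : 'I_n -> R, \sum_(i < n) phi (c i) * t i = 0 -> forall i, phi (c i) = 0.

Lemma span_memD n (t : 'I_n -> S) x y :
  span_mem t x -> span_mem t y -> span_mem t (x + y).
Proof.
move=> [c ->] [d ->]; exists (fun i => c i + d i); rewrite -big_split /=.
by apply: eq_bigr => i _; rewrite rmorphD mulrDl.
Qed.

Lemma span_memZ n (t : 'I_n -> S) r x : span_mem t x -> span_mem t (phi r * x).
Proof.
move=> [c ->]; exists (fun i => r * c i); rewrite mulr_sumr.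
by apply: eq_bigr => i _; rewrite rmorphM mulrA.
Qed.

Lemma span_mem0 n (t : 'I_n -> S) : span_mem t 0.
Proof. by exists (fun=> 0); rewrite big1 // => i _; rewrite rmorph0 mul0r. Qed.

Hypothesis domS : is_domain S.

(** Greedy selection: a new [x] either has a nonzero multiple in the current span, whose coefficient
    joins the common denominator [a], or it extends the free family. If [s] generates [S], this
    amounts to a basis of the fraction field of [S] over that of the image of [phi]. *)
Lemma free_subfamily (s : seq S) : exists n (t : 'I_n -> S) (a : R),
  [/\ phi a <> 0, free_family t & forall x, x \in s -> span_mem t (phi a * x)].
Proof.
elim: s => [|x s [n [t [a [a0 frt spt]]]]].
  exists 0%N, (fun=> 0), 1; split=> // [|c _ []] //.
  by rewrite rmorph1; apply/eqP; case: domS.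
have [[c [c0 spc]]|nsp] := pselect (exists c, phi c <> 0 /\ span_mem t (phi c * x)).
  exists n, t, (c * a); split=> //.
    by rewrite rmorphM => E; case: domS => _ /(_ _ _ E) [].
  move=> y; rewrite inE => /predU1P [->|/spt spy].
    by rewrite [c * a]mulrC rmorphM -mulrA; apply: span_memZ.
  by rewrite rmorphM -mulrA; apply: span_memZ.
pose t' (i : 'I_n.+1) := if unlift ord0 i is Some j then t j else x.
have sumE c : \sum_(i < n.+1) phi (c i) * t' i =
    phi (c ord0) * x + \sum_(i < n) phi (c (lift ord0 i)) * t i.
  rewrite big_ord_recl /t' unlift_none; congr (_ + _).
  by apply: eq_bigr => i _; rewrite liftK.
exists n.+1, t', a; split=> // [c|y].
  rewrite sumE => E; have c0 : phi (c ord0) = 0.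
    apply: contrapT => c0; apply: nsp; exists (c ord0); split=> //.
    exists (fun i => - c (lift ord0 i)).
    rewrite -[LHS](addrK (\sum_(i < n) phi (c (lift ord0 i)) * t i)) E sub0r.
    by rewrite -sumrN; apply: eq_bigr => i _; rewrite rmorphN mulNr.
  move: E; rewrite c0 mul0r add0r => /frt ct i.
  by case: (unliftP ord0 i) => [j|] ->.
rewrite inE => /predU1P [->|/spt [c ->]].
  exists (fun i => if i == ord0 then a else 0); rewrite sumE eqxx big1 ?addr0 //.
  by move=> i _; rewrite rmorph0 mul0r.
exists (fun i => if unlift ord0 i is Some j then c j else 0).
rewrite sumE unlift_none rmorph0 mul0r add0r.
by apply: eq_bigr => i _; rewrite liftK.
Qed.

(** Multiples by [phi a] have coordinates in the free family, and [theta] reads off one in which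
    [phi a * d] is nonzero. It takes values in [S] because coordinates are determined only after
    applying [phi]. *)
Lemma exists_nonvanishing_functional d : module_finite phi -> d <> 0 ->
  exists theta : S -> S, [/\ {morph theta : x y / x + y},
    (forall r x, theta (phi r * x) = phi r * theta x),
    (forall x, exists r, theta x = phi r) & theta d <> 0].
Proof.
move=> [s gens] d0; have [n [t [a [a0 frt spt]]]] := free_subfamily s.
have sp y : span_mem t (phi a * y).
  have [c ->] := gens y; rewrite mulr_sumr.
  elim/big_ind: _ => [||i _]; [exact: span_mem0 | exact: span_memD |].
  by rewrite mulrCA; apply/span_memZ/spt; rewrite mem_nth.
have [e eE] := choice sp.
have uniq_coord c c' : \sum_(i < n) phi (c i) * t i = \sum_(i < n) phi (c' i) * t i ->
    forall i, phi (c i) = phi (c' i).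
  move=> E i; apply/eqP; rewrite -subr_eq0 -rmorphB; apply/eqP.
  move: i; apply: frt.
  transitivity (\sum_(i < n) phi (c i) * t i - \sum_(i < n) phi (c' i) * t i).
    by rewrite -sumrB; apply: eq_bigr => i _; rewrite rmorphB mulrBl.
  by rewrite E subrr.
have [i edi] : exists i, phi (e d i) <> 0.
  apply: contrapT => ne; case: domS => _ /(_ (phi a) d) [] //.
  rewrite eE big1 // => i _; suff -> : phi (e d i) = 0 by rewrite mul0r.
  by apply: contrapT => edi; apply: ne; exists i.
exists (fun x => phi (e x i)); split=> //; last by move=> x; exists (e x i).
- move=> x y; rewrite -rmorphD; apply: (uniq_coord _ (fun j => e x j + e y j)).
  rewrite -eE mulrDr !eE -big_split /=.
  by apply: eq_bigr => j _; rewrite rmorphD mulrDl.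
- move=> r x; rewrite -rmorphM; apply: (uniq_coord _ (fun j => r * e x j)).
  rewrite -eE mulrCA eE mulr_sumr.
  by apply: eq_bigr => j _; rewrite rmorphM mulrA.
Qed.

(** A functional [theta] nonzero at the multiplier [d] maps the extension of the Frobenius power of
    [I] into its image under [phi], and maps [d * phi r ^+ q] to [phi r ^+ q * theta d]. So [c] with
    [phi c = theta d] is a multiplier over [R], modulo the kernel. *)
Lemma tight_closure_contract p I r : prime p -> p%:R = 0 :> S -> module_finite phi ->
  tight_closure p (gen_ideal (image_pred phi I)) (phi r) ->
  exists c, phi c <> 0 /\ exists N, forall e, (N <= e)%N ->
    exists x, frob_power (p ^ e) I x /\ phi (c * r ^+ (p ^ e)) = phi x.
Proof.
move=> pr_p p0 mf [d [dP [N dN]]].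
have d0 : d <> 0 := dP _ (domain_zero_minimal domS).
have [theta [thD thZ thR thd]] := exists_nonvanishing_functional mf d0.
have [c thc] := thR d; exists c; split; first by rewrite -thc.
exists N => e le_e; have /(frob_power_gen_image pr_p p0) := dN e le_e.
set K := frob_power (p ^ e) I.
have [K0 KD KM] : is_ideal K by apply: gen_ideal_ideal.
(* Quantifying over all multiples [w * y] makes [J] an ideal of [S], although [theta] is linear only
   over [R]. *)
pose J y := forall w, exists x, K x /\ theta (w * y) = phi x.
have idJ : is_ideal J.
  split=> [w|x y Jx Jy w|z y Jy w].
  - exists 0; split=> //; rewrite mulr0 rmorph0; apply: (addrI (theta 0)).
    by rewrite -thD !addr0.
  - have [x' [Kx E]] := Jx w; have [y' [Ky E']] := Jy w.
    by exists (x' + y'); split; [exact: KD | rewrite mulrDr thD rmorphD E E'].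
  - by have [x [Kx E]] := Jy (w * z); exists x; rewrite mulrA.
move=> /(_ J idJ) Jd; have [|x [Kx E]] := Jd _ 1.
  move=> _ [x [Kx ->]] w; have [w' E] := thR w; exists (w' * x); split; first exact: KM.
  by rewrite mulrC thZ E rmorphM mulrC.
exists x; split=> //.
by rewrite -E mul1r [d * _]mulrC -rmorphXn thZ thc rmorphM mulrC.
Qed.

End ModuleFinite.

(** * Reduction modulo minimal primes *)

Section TightClosureModPrime.
Variables (p : nat) (R : comPzRingType).
Hypotheses (pr_p : prime p) (p0 : p%:R = 0 :> R).
Implicit Types (I P U : R -> Prop) (z : R).

(* [z] lies in the tight closure of [I(R/P)] in the domain [R/P]. *)
Definition tight_mod I P z : Prop := exists c, ~ P c /\ exists N, forall e, (N <= e)%N ->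
  exists x, frob_power (p ^ e) I x /\ P (c * z ^+ (p ^ e) - x).

Lemma tight_mod_mul I P u z : is_prime_ideal P -> tight_mod I P z -> tight_mod I P (u * z).
Proof.
move=> [[P0 _ PM] _ _] [c [nPc [N cN]]]; exists c; split=> //.
exists N => e /cN [x [Ix Px]]; exists (u ^+ (p ^ e) * x); split.
  by have [_ _] := frob_power_ideal (p ^ e) I; apply.
by rewrite exprMn mulrCA -mulrBr; apply: PM.
Qed.

(** Raise [c * z ^+ q - x], an element of [P], to the power [p ^ n]: Frobenius splits the
    difference, and [d] kills the result since [n <= p ^ n]. Thus [d * c ^+ (p ^ n)] works without
    reduction modulo [P]. *)
Lemma tight_mod_lift I P z : noetherian R -> is_minimal_prime P -> tight_mod I P z ->
  exists c, ~ P c /\ exists N, forall e, (N <= e)%N ->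
    frob_power (p ^ e) I (c * z ^+ (p ^ e)).
Proof.
move=> noeth minP [c [nPc [N cN]]]; have [prP _] := minP.
have [d [n [nPd dn]]] := minimal_prime_nilpotent noeth minP.
exists (d * c ^+ (p ^ n)); split; first by apply: primeM => //; apply: primeX.
(* The congruence modulo [P] is used at exponent [e - n], which must be at least [N], and then
   raised to the power [p ^ n]. *)
exists (N + n)%N => e le_e.
have le_ne : (n <= e)%N by rewrite (leq_trans _ le_e) ?leq_addl.
have [|x [Ix Px]] := cN (e - n)%N; first by rewrite leq_subRL // addnC.
have eE : e = (e - n + n)%N by rewrite subnK.
have dx : d * c ^+ (p ^ n) * z ^+ (p ^ e) = d * x ^+ (p ^ n).
  apply/eqP; rewrite -subr_eq0 {1}eE expnD exprM -mulrA -exprMn -mulrBr.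
  have -> : (c * z ^+ (p ^ (e - n))) ^+ (p ^ n) - x ^+ (p ^ n) =
      (c * z ^+ (p ^ (e - n)) - x) ^+ (p ^ n).
    by apply/eqP; rewrite subr_eq -frobD // subrK.
  have /ltnW/subnK <- : (n < p ^ n)%N by rewrite ltn_expl // prime_gt1.
  by rewrite addnC exprD mulrA dn // mul0r.
rewrite dx eE.
have [_ _] := frob_power_ideal (p ^ (e - n + n)) I.
by apply; apply: frob_power_expr.
Qed.

(** The multipliers that work for all large [e] form an ideal [J]; lifting shows that no minimal
    prime contains it, so prime avoidance gives one multiplier outside them all. *)
Lemma tight_closure_of_tight_mod I z : noetherian R ->
  (forall P, is_minimal_prime P -> tight_mod I P z) -> tight_closure p I z.
Proof.
move=> noeth tm.
pose J c := exists N, forall e, (N <= e)%N -> frob_power (p ^ e) I (c * z ^+ (p ^ e)).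
have idq q := frob_power_ideal q I.
have [] := @minimal_prime_avoidance R J noeth.
- move=> x y [N xN] [M yM]; exists (maxn N M) => e; rewrite geq_max => /andP [leN leM].
  by rewrite mulrDl; case: (idq (p ^ e)%N) => _ ID _; apply: ID; [apply: xN | apply: yM].
- move=> r x [N xN]; exists N => e leN; rewrite -mulrA.
  by case: (idq (p ^ e)%N) => _ _; apply; apply: xN.
- by exists 0%N => e _; rewrite mul0r; case: (idq (p ^ e)%N).
- by move=> P minP; have [c [nPc cJ]] := tight_mod_lift noeth minP (tm P minP); exists c.
- by move=> c [Jc nPc]; exists c.
Qed.

Lemma tight_mod_of_loc I U (B : comPzRingType) (f : {rmorphism R -> B}) P
    (S : comPzRingType) (phi : {rmorphism R -> S}) a u b :
  is_ideal I -> mult_system U -> is_localization U f -> is_minimal_prime P ->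
  is_domain S -> (forall r, phi r = 0 <-> P r) -> module_finite phi ->
  tc_commutes_with_localization p S ->
  U u -> b * f u = f a -> tight_closure p (gen_ideal (image_pred f I)) b ->
  exists v, U v /\ tight_mod I P (v * a).
Proof.
move=> idI multU locf minP domS kerphi mf tcS Uu E [c [nc [N cN]]].
have [prP _] := minP; have [U1 UM] := multU.
have [[v [Uv Pv]]|UP] := pselect (exists v, U v /\ P v).
  have [idP P1 _] := prP.
  (* All positive powers of [v * a] lie in [P], so multiplier 1 and [x = 0] suffice. *)
  exists v; split=> //; exists 1; split=> //; exists 0%N => e _; exists 0; split.
    by case: (frob_power_ideal (p ^ e) I).
  rewrite mul1r subr0; apply: ideal_exprn => //; first exact: pexp_gt0.
  exact: ideal_mulr.
have PU v : U v -> ~ P v by move=> Uv Pv; apply: UP; exists v.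
(* The numerator [c'] of the multiplier [c] is outside [P], because [P] extends to a minimal prime
   of [B]. *)
have [_ fr _] := locf; have [c' [v [Uv Ec]]] := fr c.
have nPc' : ~ P c'.
  by move=> Pc'; apply: (nc _ (loc_ext_minimal multU locf minP PU)); exists c', v.
pose V (s : S) := exists2 w, U w & s = phi w.
have multV : mult_system V.
  split; first by exists 1; rewrite ?rmorph1.
  by move=> _ _ [w Uw ->] [w' Uw' ->]; exists (w * w'); rewrite ?rmorphM //; apply: UM.
have V0 : ~ V 0 by move=> [w Uw /esym /kerphi /(PU w Uw)].
have [T [g locg]] := localization_exists multV.
have domT := loc_domain multV locg domS V0.
have p0S : p%:R = 0 :> S by rewrite -(rmorph_nat phi) p0 rmorph0.
pose IS := gen_ideal (image_pred phi I).
have idIS : is_ideal IS by apply: gen_ideal_ideal.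
(* The image of [c'] serves as multiplier in [T]: the only minimal prime of the domain [T] is zero,
   and that image is nonzero. *)
have tcT : tight_closure p (gen_ideal (image_pred g IS)) (g (phi a)).
  exists (g (phi c')); split.
    move=> Q minQ /(domain_minimalE domT minQ).
    case: (locg) => _ _ h /h [_ [[w Uw ->]]].
    by rewrite -rmorphM => /kerphi; apply: primeM (PU w Uw) nPc'.
  exists N => e /cN /(frob_power_gen_image pr_p).
  rewrite -(rmorph_nat f) p0 rmorph0 => /(_ erefl).
  move=> /(gen_image_locE multU locf _ (gen_ideal_ideal _)) [y [w [Iy Uw Ey]]].
  (* Clearing the denominators of [c], [b] and the Frobenius membership moves the relation to [R],
     up to a factor [w'] of [U]; [phi] then carries it to [S]. *)
  have : f (c' * a ^+ (p ^ e) * w) = f (y * (v * u ^+ (p ^ e))).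
    by rewrite !rmorphM !rmorphXn -Ec -E -Ey exprMn; ring.
  move=> /(loc_eq locf) [w' [Uw' Ew']].
  have [t tw] : exists t, t * g (phi (w' * w)) = 1.
    by apply: (loc_unitK locg); exists (w' * w) => //; apply: UM.
  have -> : g (phi c') * g (phi a) ^+ (p ^ e) =
      t * g (phi (w' * (v * u ^+ (p ^ e)))) * g (phi y).
    rewrite -[LHS]mul1r -tw -mulrA -[RHS]mulrA; congr (t * _).
    rewrite -!rmorphXn -!rmorphM; congr (g (phi _)).
    transitivity (w' * (c' * a ^+ (p ^ e) * w)); first by ring.
    by rewrite Ew'; ring.
  have [_ _] := frob_power_ideal (p ^ e) (gen_ideal (image_pred g IS)).
  by apply; do 2!apply: frob_power_image.
(* Commutation in [S] gives a fraction with numerator [s] in the tight closure of [IS]; clearing its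
   denominator shows that [phi (w * w' * a)] lies there too. *)
have := proj2 (tcS IS V T g idIS multV locg (g (phi a))) tcT.
have idtc := tight_closure_ideal pr_p IS p0S.
move=> /(gen_image_locE multV locg _ idtc) [s [_ [tcs [w Uw ->]]]].
rewrite -rmorphM => /(loc_eq locg) [_ [[w' Uw' ->] Es]].
have Uww' : U (w * w') by apply: UM.
exists (w * w'); split=> //.
have : tight_closure p IS (phi (w * w' * a)).
  have -> : phi (w * w' * a) = phi w' * s by rewrite -Es !rmorphM; ring.
  by case: idtc => _ _; apply.
move=> /(tight_closure_contract domS pr_p p0S mf) [d [d0 [M dM]]].
exists d; split; first by move=> /kerphi.
exists M => e /dM [x [Ix Ex]]; exists x; split=> //.
by apply/kerphi; rewrite rmorphB Ex subrr.
Qed.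

End TightClosureModPrime.

(** * Gluing over the minimal primes *)

Theorem mainTheorem1 (p : nat) (R : comPzRingType) :
  prime p -> (p%:R = 0 :> R) -> noetherian R ->
  (forall P : R -> Prop, is_minimal_prime P ->
     exists (S : comPzRingType) (phi : {rmorphism R -> S}),
       [/\ is_domain S,
           (forall r, phi r = 0 <-> P r),
           module_finite phi &
           tc_commutes_with_localization p S]) ->
  tc_commutes_with_localization p R.
Proof.
move=> pr_p p0 noeth ext I U B f idI multU locf b; split.
  exact: (gen_image_tight_closure_sub multU locf pr_p p0).
move=> tcb; have [U1 UM] := multU; have [_ /(_ b) [a [u [Uu E]]] _] := locf.
(* The fraction [b] also has numerator [v * a] and denominator [v * u]. *)
suff [v [Uv tcv]] : exists v, U v /\ tight_closure p I (v * a).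
  apply/(gen_image_locE multU locf _ (tight_closure_ideal pr_p I p0)).
  exists (v * a), (v * u); split=> //; first exact: UM.
  by rewrite !rmorphM mulrCA E.
have [L minL] := noetherian_finite_minimal_primes noeth.
suff [v [Uv tmv]] : exists v, U v /\
    forall P, is_minimal_prime P -> P \in L -> tight_mod p I P (v * a).
  exists v; split=> //; apply: tight_closure_of_tight_mod => // P minP.
  by apply: tmv => //; apply: minL.
elim: L {minL} => [|P L [v [Uv tmv]]]; first by exists 1.
have [minP|nminP] := pselect (is_minimal_prime P); last first.
  exists v; split=> // Q minQ; rewrite inE => /predU1P [QP|]; last exact: tmv.
  by rewrite QP in minQ.
have [S [phi [domS kerphi mf tcS]]] := ext P minP.
have [w [Uw tmw]] :=
  tight_mod_of_loc pr_p p0 idI multU locf minP domS kerphi mf tcS Uu E tcb.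
(* The factor [w] handles [P] and [v] the primes already treated, since [tight_mod] is stable under
   multiples. *)
exists (v * w); split=> [|Q minQ]; first exact: UM.
rewrite inE => /predU1P [->|QL]; first by rewrite -mulrA; apply: tight_mod_mul; case: minP.
by rewrite mulrAC mulrC; apply: tight_mod_mul; [case: minQ | apply: tmv].
Qed.
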